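(* Let $d_1,d_2,n$ be positive integers. (a) If $n\geq d_1+d_2+1$, then $\operatorname{ALM}(d_1,d_2,n)$ is exactly matchable. (b) If $n<d_1+d_2+1$, then $\operatorname{ALM}(d_1,d_2,n)$ is not exactly matchable.
   Context: Affine linear model. Given $d_1,d_2,n\in\mathbb{N}=\{1,2,\dots\}$, the affine linear model $\operatorname{ALM}(d_1,d_2,n)$ receives a probability distribution $\mathbb{P}$ over some real vector space $\mathbb{R}^D$ and returns the random function \[ \mathcal{E}_{\mathbb{P}}\colon(S_1,\mu_1,S_2,\mu_2)\mapsto\{S_i\omega_j+\mu_i\}_{i\in\{1,2\},j\in[n]} \] defined over all $S_i\in\mathbb{R}^{d_i\times D}$ and $\mu_i\in\mathbb{R}^{d_i}$ ($i\in\{1,2\}$), where $\{\omega_j\}_{j\in[n]}$ are drawn independently with distribution $\mathbb{P}$. Exactly matchable. $\operatorname{ALM}(d_1,d_2,n)$ is exactly matchable if there exists a measurable function \[ \mathcal{D}\colon\{x_{ij}\}_{i\in\{1,2\},j\in[n]}\mapsto(A_1,b_1,A_2,b_2) \] (with $x_{ij}\in\mathbb{R}^{d_i}$, and output $A_i\in\mathbb{R}^{k\times d_i}$, $b_i\in\mathbb{R}^k$ for a positive integer $k$ that may depend on the input $\{x_{ij}\}$) such that for every $D\in\mathbb{N}$, every continuous probability distribution $\mathbb{P}$ over $\mathbb{R}^D$, and every input $(S_1,\mu_1,S_2,\mu_2)$ with $S_i\in\mathbb{R}^{d_i\times D}$, $\mu_i\in\mathbb{R}^{d_i}$, the random tuple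 \[ (A_1,b_1,A_2,b_2):=(\mathcal{D}\circ\mathcal{E}_{\mathbb{P}})(S_1,\mu_1,S_2,\mu_2) \] almost surely satisfies both (i) $A_1(S_1\omega+\mu_1)+b_1=A_2(S_2\omega+\mu_2)+b_2$ for all $\omega\in\mathbb{R}^D$, and (ii) $\ker A_iS_i=\ker S_1+\ker S_2$ for $i\in\{1,2\}$. Here ''continuous probability distribution over $\mathbb{R}^D$'' means absolutely continuous with respect to Lebesgue measure on $\mathbb{R}^D$. *)

(* Defs.v *)
From HB Require Import structures.
From mathcomp Require Import all_boot all_order all_algebra.
From mathcomp Require Import all_classical all_reals all_analysis.

Set Implicit Arguments.
Unset Strict Implicit.
Unset Printing Implicit Defensive.

Import Order.TTheory GRing.Theory Num.Theory.
Import numFieldNormedType.Exports.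

Local Open Scope classical_set_scope.
Local Open Scope ring_scope.

(* Matrices carry the product sigma-algebra, generated by the entries. For
   T := R : realType it is the Borel sigma-algebra. *)
Definition measure_matrix_display : measure_display -> measure_display.
Proof. exact. Qed.

Section measurable_matrix.
Context {d : measure_display} {T : measurableType d} (m n : nat).

Definition matrix_sigma_algebra : set (set 'M[T]_(m, n)) :=
  <<s \bigcup_(ij in [set: 'I_m * 'I_n])
        preimage_set_system setT (fun M : 'M[T]_(m, n) => M ij.1 ij.2)
          measurable >>.

Let matrix_set0 : matrix_sigma_algebra set0.
Proof. exact: sigma_algebra0. Qed.

Let matrix_setC A : matrix_sigma_algebra A -> matrix_sigma_algebra (~` A).
Proof. exact: sigma_algebraC. Qed.

Let matrix_bigcup (F : (set 'M[T]_(m, n))^nat) :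
  (forall i, matrix_sigma_algebra (F i)) ->
  matrix_sigma_algebra (\bigcup_i F i).
Proof. exact: sigma_algebra_bigcup. Qed.

HB.instance Definition _ := @isMeasurable.Build (measure_matrix_display d)
  'M[T]_(m, n) matrix_sigma_algebra matrix_set0 matrix_setC matrix_bigcup.

End measurable_matrix.

Lemma pushforward_sigma_additive (d1 d2 : measure_display)
    (T1 : measurableType d1) (T2 : measurableType d2) (R : realType)
    (m : {measure set T1 -> \bar R}) (f : T1 -> T2) :
  measurable_fun setT f -> semi_sigma_additive (pushforward m f).
Proof.
move=> mf F mF tF mUF; rewrite /pushforward preimage_bigcup.
have mpre A : measurable A -> measurable (f @^-1` A).
  by move=> mA; rewrite -[X in measurable X]setTI; exact: mf.
apply: measure_semi_sigma_additive.
- by move=> k; exact: mpre.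
- apply/trivIsetP => /= i j _ _ ij; rewrite -preimage_setI.
  by move/trivIsetP : tF => /(_ _ _ _ _ ij) ->//; rewrite preimage_set0.
- by rewrite -preimage_bigcup; exact: mpre.
Qed.

Lemma product_measure_sigma_finite (d1 d2 : measure_display)
    (T1 : measurableType d1) (T2 : measurableType d2) (R : realType)
    (m1 : {sigma_finite_measure set T1 -> \bar R})
    (m2 : {sigma_finite_measure set T2 -> \bar R}) :
  sigma_finite setT (m1 \x m2)%E.
Proof.
have /sigma_finiteP[F [TF ndF Foo]] := sigma_finiteT m1.
have /sigma_finiteP[G [TG ndG Goo]] := sigma_finiteT m2.
exists (fun n => F n `*` G n).
  rewrite -setXTT TF TG predeqE => -[x y]; split.
    move=> [/= [n _ Fnx] [k _ Gky]]; exists (maxn n k) => //; split.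
    - by move: x Fnx; exact/subsetPset/ndF/leq_maxl.
    - by move: y Gky; exact/subsetPset/ndG/leq_maxr.
  by move=> [n _ []/= ? ?]; split; exists n.
move=> k; have [? ?] := Foo k; have [? ?] := Goo k.
split; first exact: measurableX.
by rewrite product_measure1E// lte_mul_pinfty// ge0_fin_numE.
Qed.

Section cons_measure.
Local Open Scope ereal_scope.
Context {d : measure_display} {T : measurableType d} {R : realType} {n : nat}.

Definition tuple_cons (x : T * n.-tuple T) : n.+1.-tuple T :=
  [tuple of x.1 :: x.2].

Lemma measurable_tuple_cons : measurable_fun setT tuple_cons.
Proof. exact: measurable_cons. Qed.

Variables (m1 : {sigma_finite_measure set T -> \bar R})
  (m2 : {sigma_finite_measure set (n.-tuple T) -> \bar R}).

Definition cons_measure : set (n.+1.-tuple T) -> \bar R :=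
  pushforward (m1 \x m2) tuple_cons.

Let cons_measure0 : cons_measure set0 = 0.
Proof. by rewrite /cons_measure /pushforward preimage_set0 measure0. Qed.

Let cons_measure_ge0 A : 0 <= cons_measure A.
Proof. by rewrite /cons_measure /pushforward measure_ge0. Qed.

Let cons_measure_sigma_additive : semi_sigma_additive cons_measure.
Proof. exact: (pushforward_sigma_additive measurable_tuple_cons). Qed.

HB.instance Definition _ := isMeasure.Build _ _ _ cons_measure
  cons_measure0 cons_measure_ge0 cons_measure_sigma_additive.

Let cons_measure_sigma_finite : sigma_finite setT cons_measure.
Proof.
have [F UF mF] := product_measure_sigma_finite m1 m2.
pose g (t : n.+1.-tuple T) : T * n.-tuple T := (thead t, [tuple of behead t]).
have gK : cancel tuple_cons g.
  by move=> [x t]; congr pair; apply/val_inj.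
have mg : measurable_fun setT g.
  apply/measurable_fun_pairP; split; first exact: measurable_tnth.
  exact: measurable_behead.
exists (fun k => g @^-1` F k).
  by rewrite -preimage_bigcup -UF preimage_setT.
move=> k; have [mFk Fkoo] := mF k; split.
  by rewrite -[X in measurable X]setTI; exact: mg.
rewrite /cons_measure /pushforward -comp_preimage.
by rewrite (_ : g \o tuple_cons = id) //; apply/funext => x /=; rewrite gK.
Qed.

HB.instance Definition _ := Measure_isSigmaFinite.Build _ _ _ cons_measure
  cons_measure_sigma_finite.

End cons_measure.

(* The n-fold product measure m \x ... \x m. *)
Fixpoint power_measure {d : measure_display} {T : measurableType d}
    {R : realType} (m : {sigma_finite_measure set T -> \bar R}) (n : nat) :
    {sigma_finite_measure set (n.-tuple T) -> \bar R} :=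
  match n with
  | 0 => \d_ [tuple]
  | n'.+1 => cons_measure m (power_measure m n')
  end.

Lemma power_measure_box (d : measure_display) (T : measurableType d)
    (R : realType) (m : {sigma_finite_measure set T -> \bar R}) (n : nat)
    (A : 'I_n -> set T) :
  (forall i, measurable (A i)) ->
  (power_measure m n [set t | forall i, A i (tnth t i)] =
   \prod_i m (A i))%E.
Proof.
elim: n A => [|n IH] A mA.
  by rewrite big_ord0 /= diracE mem_set// => -[].
rewrite big_ord_recl -IH //=.
rewrite /cons_measure /pushforward -product_measure1E //.
  congr (_ _); apply/seteqP; split => -[x t] /=.
    move=> H; split; first exact: (H ord0).
    by move=> i; have := H (lift ord0 i); rewrite tnthS.
  move=> [H1 H2] i; case: (unliftP ord0 i) => [j ->|->//].
  by rewrite tnthS.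
rewrite (_ : mkset _ =
  \bigcap_(i in setT) ((@tnth _ _ ^~ i) @^-1` (A (lift ord0 i)))); last first.
  by apply/seteqP; split => t /= H i; [move=> _; exact: (H i)|exact: (H i I)].
apply: fin_bigcap_measurable => // i _.
by rewrite -[X in measurable X]setTI; exact: measurable_tnth.
Qed.

Definition col_of_tuple {T : Type} {n : nat} (t : n.-tuple T) : 'cV[T]_n :=
  \col_i tnth t i.

Section lebesgue_measure_cV.
Context {R : realType} (D : nat).

Lemma measurable_col_of_tuple :
  measurable_fun [set: D.-tuple (measurableTypeR R)]
    (col_of_tuple : D.-tuple (measurableTypeR R) -> 'cV[R]_D).
Proof.
apply: measurability => // _ [_ [[i j] _ [A mA <-]] <-].
rewrite !setTI -comp_preimage (_ : _ \o _ = @tnth _ _ ^~ i).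
  by rewrite -[X in measurable X]setTI; exact: measurable_tnth.
by apply/funext => t; rewrite /= mxE.
Qed.

Definition lebesgue_measure_cV : set 'cV[R]_D -> \bar R :=
  pushforward (power_measure (@lebesgue_measure R) D) col_of_tuple.

Let lebesgue_measure_cV0 : lebesgue_measure_cV set0 = 0%E.
Proof. by rewrite /lebesgue_measure_cV /pushforward preimage_set0 measure0. Qed.

Let lebesgue_measure_cV_ge0 A : (0 <= lebesgue_measure_cV A)%E.
Proof. by rewrite /lebesgue_measure_cV /pushforward measure_ge0. Qed.

Let lebesgue_measure_cV_sigma_additive :
  semi_sigma_additive lebesgue_measure_cV.
Proof. exact: (pushforward_sigma_additive measurable_col_of_tuple). Qed.

HB.instance Definition _ := isMeasure.Build _ _ _ lebesgue_measure_cV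
  lebesgue_measure_cV0 lebesgue_measure_cV_ge0
  lebesgue_measure_cV_sigma_additive.

Lemma lebesgue_measure_cV_box (a b : 'cV[R]_D) :
  (forall i, a i ord0 <= b i ord0) ->
  lebesgue_measure_cV
    [set v : 'cV[R]_D | forall i, a i ord0 <= v i ord0 <= b i ord0] =
  (\prod_i (b i ord0 - a i ord0)%:E)%E.
Proof.
move=> ab; transitivity (power_measure (@lebesgue_measure R) D
    [set t | forall i, [set` `[a i ord0, b i ord0]] (tnth t i)]).
  rewrite /lebesgue_measure_cV /pushforward; congr (power_measure _ _ _).
  by apply/seteqP; split=> t /= H i; have := H i; rewrite in_itv /= !mxE.
rewrite (@power_measure_box _ _ _ (@lebesgue_measure R) D
  (fun i => [set` `[a i ord0, b i ord0]])).
  apply: eq_bigr => i _.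
  etransitivity; first exact: (lebesgue_measure_itv `[a i ord0, b i ord0]).
  rewrite /= lte_fin lt_neqAle ab andbT.
  by case: eqP => //= ->; rewrite subrr.
by move=> i; exact: measurable_itv.
Qed.

End lebesgue_measure_cV.

Section matching.
Context (R : realType) (d1 d2 : nat).

(* Tuples (A_1, b_1, A_2, b_2) with common target dimension k.+1, so that
   k : nat enumerates the positive target dimensions. *)
Definition matching (k : nat) : Type :=
  ('M[R]_(k.+1, d1) * 'cV[R]_k.+1 * ('M[R]_(k.+1, d2) * 'cV[R]_k.+1))%type.

HB.instance Definition _ k := Measurable.on (matching k).

Definition any_matching : Type := {k : nat & matching k}.

HB.instance Definition _ := gen_eqMixin any_matching.
HB.instance Definition _ := gen_choiceMixin any_matching.
HB.instance Definition _ := isPointed.Build any_matching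
  (existT matching 0%N point).

(* The disjoint-union sigma-algebra: A is measurable if and only if its trace
   on every summand is. *)
Definition any_matching_measurable : set (set any_matching) :=
  [set A | forall k, measurable (existT matching k @^-1` A)].

Let any_matching_set0 : any_matching_measurable set0.
Proof. by move=> k; rewrite preimage_set0; exact: measurable0. Qed.

Let any_matching_setC A :
  any_matching_measurable A -> any_matching_measurable (~` A).
Proof. by move=> mA k; rewrite preimage_setC; apply: measurableC; exact: mA. Qed.

Let any_matching_bigcup (F : (set any_matching)^nat) :
  (forall i, any_matching_measurable (F i)) ->
  any_matching_measurable (\bigcup_i F i).
Proof.
by move=> mF k; rewrite preimage_bigcup; apply: bigcupT_measurable => i; exact: mF.
Qed.

HB.instance Definition _ := @isMeasurable.Build default_measure_display
  any_matching any_matching_measurable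
  any_matching_set0 any_matching_setC any_matching_bigcup.

End matching.

Section affine_linear_model.
Context {R : realType} (d1 d2 n : nat).

(* The data {x_ij} with i in {1, 2} and j in [n]. *)
Definition sample : Type := (n.-tuple 'cV[R]_d1 * n.-tuple 'cV[R]_d2)%type.

HB.instance Definition _ := Measurable.on sample.

Definition alm {D : nat} (S1 : 'M[R]_(d1, D)) (mu1 : 'cV[R]_d1)
    (S2 : 'M[R]_(d2, D)) (mu2 : 'cV[R]_d2) (w : n.-tuple 'cV[R]_D) : sample :=
  ([tuple S1 *m tnth w j + mu1 | j < n], [tuple S2 *m tnth w j + mu2 | j < n]).

(* kermx M is spanned by the rows u with u *m M = 0, so kermx M^T represents
   the kernel of M acting on column vectors. *)
Definition exact_matching {D : nat} (S1 : 'M[R]_(d1, D)) (mu1 : 'cV[R]_d1)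
    (S2 : 'M[R]_(d2, D)) (mu2 : 'cV[R]_d2) (o : any_matching R d1 d2) : Prop :=
  let: existT k ((A1, b1), (A2, b2)) := o in
  [/\ forall omega : 'cV[R]_D,
        A1 *m (S1 *m omega + mu1) + b1 = A2 *m (S2 *m omega + mu2) + b2,
      (kermx (A1 *m S1)^T == kermx S1^T + kermx S2^T)%MS &
      (kermx (A2 *m S2)^T == kermx S1^T + kermx S2^T)%MS].

(* The independent draws omega_1, ..., omega_n with distribution P are realised
   as the coordinates under the n-fold product of P. *)
Definition exactly_matchable : Prop :=
  exists2 dec : sample -> any_matching R d1 d2, measurable_fun setT dec &
    forall (D : nat) (P : probability 'cV[R]_D R),
      (0 < D)%N -> P `<< @lebesgue_measure_cV R D ->
    forall (S1 : 'M[R]_(d1, D)) (mu1 : 'cV[R]_d1)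
        (S2 : 'M[R]_(d2, D)) (mu2 : 'cV[R]_d2),
      {ae power_measure P n, forall w,
        exact_matching S1 mu1 S2 mu2 (dec (alm S1 mu1 S2 mu2 w))}.

End affine_linear_model.

Arguments exactly_matchable R d1 d2 n : clear implicits.

(* Main.v *)
Require Import Defs.
From HB Require Import structures.
From mathcomp Require Import all_boot all_order all_algebra.
From mathcomp Require Import all_classical all_reals all_analysis.
From mathcomp Require Import measurable_realfun.

(** Write every sample column as x_j = (1, x_1j, x_2j), a vector of
    R^(1 + (d1 + d2)).  It equals M (1, omega_j), where M is the matrix
    [stacked_mx S1 mu1 S2 mu2] that encodes the two affine maps together.  A
    matching is then nothing but a family of row vectors (b, A1, - A2) that
    annihilate M on the left, and condition (ii) asks for enough of them: the
    rows of A1 S1 = A2 S2 must fill the intersection of the row spaces of S1 and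
    S2, the orthogonal complement of ker S1 + ker S2 ([ker_meet]).

    Part (a).  For an absolutely continuous law the vectors (1, omega_j) are in
    general position ([generic_det_null]: a determinant is affine in the first
    draw, with a coefficient that is generically nonzero by induction, and
    hyperplanes are null).  Hence, when there are at least 1 + d1 + d2 >= rank M
    draws, the samples almost surely have the same left kernel as M
    ([generic_left_kernel]).  The decoder returns the orthogonal projector onto
    that left kernel.  It is computed by Gram-Schmidt with the convention
    0^-1 = 0, that is, by a formula without case distinction, so that it is
    visibly measurable.

    Part (b).  Let n <= d = d1 + d2 and draw omega in R^d.  If (S1, S2) is
    invertible, then A1 S1 = A2 S2 forces A1 = 0; if one coordinate of the
    second view is an affine function of all other data, and really depends on the
    first view, then (ii) forces A1 <> 0.  The two situations cannot be told
    apart from n <= d points, because n points of R^d in general position lie on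
    the graph of such an affine function.  To turn this into a contradiction
    between almost sure statements, both models are tilted by parameters t in
    R^(1 + d), the coefficients of an affine function that is added to the
    distinguished coordinate.  For generic draws w, the
    data of the first family at t are the data of the second one at t0 + t for
    some t0 = t0(w) ([tilted_alm_shift], [tilt_onto_ae]; here n <= d is used).
    By Fubini, for almost every w, A1 = 0 holds in the first family and A1 <> 0
    in the second one for almost every t; as Lebesgue null sets are invariant
    under the translation by t0 ([translation_null]), the same data would yield
    both A1 = 0 and A1 <> 0. *)

Set Implicit Arguments.
Unset Strict Implicit.
Unset Printing Implicit Defensive.

Import Order.TTheory GRing.Theory Num.Theory.
Import numFieldNormedType.Exports.

Local Open Scope classical_set_scope.
Local Open Scope ring_scope.

(** * Projection onto a left kernel, and orthogonal complements *)

Section linear_algebra.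
Variable R : realFieldType.

Definition sqnorm m (u : 'cV[R]_m) : R := (u^T *m u) 0 0.

Lemma sqnorm_eq0 m (u : 'cV[R]_m) : sqnorm u = 0 -> u = 0.
Proof.
move=> /eqP; rewrite /sqnorm mxE psumr_eq0; last first.
  by move=> i _; rewrite mxE -expr2 sqr_ge0.
move=> /allP u0; apply/colP => i; rewrite mxE.
have := u0 i (mem_index_enum _); rewrite mxE /= mulf_eq0 orbb.
by move/eqP.
Qed.

(** One Gram-Schmidt step: if [P] projects orthogonally onto the complement of
    some span, [deflate P x] does so after [x] is added to the span.  When [x]
    already belongs to the span, [P *m x = 0] and the convention [0^-1 = 0]
    leaves [P] unchanged. *)
Definition deflate m (P : 'M[R]_m) (x : 'cV[R]_m) : 'M[R]_m :=
  P - (sqnorm (P *m x))^-1 *: ((P *m x) *m (P *m x)^T).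

Definition left_ker_proj m (xs : seq 'cV[R]_m) : 'M[R]_m :=
  foldl (@deflate m) 1%:M xs.

Definition is_projector m (P : 'M[R]_m) := P^T = P /\ P *m P = P.

Lemma is_projector_deflate m (P : 'M[R]_m) x :
  is_projector P -> is_projector (deflate P x).
Proof.
move=> [PT PP]; rewrite /deflate; set u := P *m x; set s := (sqnorm u)^-1.
have Pu : P *m u = u by rewrite /u mulmxA PP.
have uP : u^T *m P = u^T by rewrite -{1}PT -trmx_mul Pu.
split; first by rewrite linearB /= linearZ /= trmx_mul trmxK PT.
have uuP : u *m u^T *m P = u *m u^T by rewrite -mulmxA uP.
have uuu : u *m u^T *m (u *m u^T) = sqnorm u *: (u *m u^T).
  rewrite mulmxA -(mulmxA u u^T u) [u^T *m u]mx11_scalar -/(sqnorm u).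
  by rewrite mul_mx_scalar -scalemxAl.
rewrite mulmxBl !mulmxBr PP -!scalemxAl -!scalemxAr mulmxA Pu uuP uuu !scalerA.
suff -> : s * s * sqnorm u = s by rewrite subrr subr0.
rewrite /s; have [->|u0] := eqVneq (sqnorm u) 0; first by rewrite invr0 !mul0r.
by rewrite -mulrA mulVf ?mulr1.
Qed.

Lemma deflate_new m (P : 'M[R]_m) x : is_projector P -> deflate P x *m x = 0.
Proof.
move=> [PT PP]; rewrite /deflate mulmxBl -scalemxAl -(mulmxA (P *m x)).
set u := P *m x; have -> : u^T *m x = u^T *m u.
  by rewrite /u trmx_mul PT mulmxA -(mulmxA x^T P P) PP.
rewrite [u^T *m u]mx11_scalar -/(sqnorm u) mul_mx_scalar scalerA.
have [/sqnorm_eq0 ->|u0] := eqVneq (sqnorm u) 0.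
  by rewrite scaler0 subrr.
by rewrite mulVf // scale1r subrr.
Qed.

Lemma deflate_old m (P : 'M[R]_m) (x y : 'cV[R]_m) :
  is_projector P -> P *m y = 0 -> deflate P x *m y = 0.
Proof.
move=> [PT _] Py; rewrite /deflate mulmxBl Py -scalemxAl -(mulmxA (P *m x)).
by rewrite trmx_mul PT -(mulmxA x^T P y) Py !mulmx0 scaler0 subrr.
Qed.

Lemma left_ker_proj_annihilates m (xs : seq 'cV[R]_m) x :
  x \in xs -> left_ker_proj xs *m x = 0.
Proof.
have : is_projector (1%:M : 'M[R]_m) by rewrite /is_projector trmx1 mul1mx.
rewrite /left_ker_proj; elim: xs 1%:M => //= y xs IH P HP.
have HP' := is_projector_deflate y HP.
rewrite inE => /predU1P[->|]; last exact: IH.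
have := deflate_new y HP.
elim: xs {IH HP} (deflate P y) HP' => //= z xs IH Q HQ Qy.
by apply: IH; [exact: is_projector_deflate|exact: deflate_old].
Qed.

Lemma left_ker_proj_fixes m (xs : seq 'cV[R]_m) (a : 'rV[R]_m) :
  (forall x, x \in xs -> a *m x = 0) -> a *m left_ker_proj xs = a.
Proof.
have : a *m 1%:M = a by rewrite mulmx1.
rewrite /left_ker_proj; elim: xs 1%:M => //= x xs IH P aP ax.
apply: IH; last by move=> y yxs; apply: ax; rewrite inE yxs orbT.
rewrite /deflate mulmxBr aP -scalemxAr mulmxA mulmxA aP ax ?inE ?eqxx //.
by rewrite mul0mx scaler0 subr0.
Qed.

(** Row spaces are their own double orthogonal complement. *)
Lemma annihilator_sub m1 m2 n (A : 'M[R]_(m1, n)) (Z : 'M[R]_(m2, n)) :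
  kermx A^T *m Z^T = 0 -> (Z <= A)%MS.
Proof.
move=> AZ; rewrite submxE -trmx_eq0 trmx_mul.
have /submxP[X ->] : ((cokermx A)^T <= kermx A^T)%MS.
  by apply/sub_kermxP; rewrite -trmx_mul mulmx_coker trmx0.
by rewrite -mulmxA AZ mulmx0.
Qed.

(** This is the duality (U1 :&: U2)^perp = U1^perp + U2^perp for the row spaces
    U1 and U2 of [S1] and [S2]: the kernels are the orthogonal complements of
    the row spaces.  The hypotheses say that [B] spans U1 :&: U2. *)
Lemma ker_meet (m1 m2 m n : nat) (S1 : 'M[R]_(m1, n)) (S2 : 'M[R]_(m2, n))
    (B : 'M[R]_(m, n)) :
  (B <= S1)%MS -> (B <= S2)%MS ->
  (forall v : 'rV_n, (v <= S1)%MS -> (v <= S2)%MS -> (v <= B)%MS) ->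
  (kermx B^T == kermx S1^T + kermx S2^T)%MS.
Proof.
move=> BS1 BS2 HB; apply/andP; split; last first.
  rewrite addsmx_sub; apply/andP; split; apply/sub_kermxP.
    by case/submxP: BS1 => X ->; rewrite trmx_mul mulmxA mulmx_ker mul0mx.
  by case/submxP: BS2 => X ->; rewrite trmx_mul mulmxA mulmx_ker mul0mx.
(* The columns of [cokermx W] span the complement of [W]; being orthogonal to
   both kernels, they lie in both row spaces, hence in that of [B]. *)
set W := (_ + _)%MS; rewrite submxE.
have kZ p (T : 'M[R]_(p, n)) : (kermx T^T <= W)%MS -> ((cokermx W)^T <= T)%MS.
  move=> TW; apply: annihilator_sub; rewrite trmxK; apply/eqP.
  by rewrite -submxE.
have ZB : ((cokermx W)^T <= B)%MS.
  apply/row_subP => i; apply: HB; apply: (submx_trans (row_sub _ _)).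
    by apply: kZ; exact: addsmxSl.
  by apply: kZ; exact: addsmxSr.
case/submxP: ZB => X /(congr1 trmx); rewrite trmxK => ->.
by rewrite trmx_mul mulmxA mulmx_ker mul0mx.
Qed.

Lemma row_free_row' m n (V : 'M[R]_(m.+1, n)) i :
  row_free V -> row_free (row' i V).
Proof.
move=> /row_freeP[B VB]; apply/row_freeP; exists (col' i B).
apply/matrixP => j k; have /matrixP/(_ (lift i j) (lift i k)) := VB.
rewrite !mxE (inj_eq lift_inj) => <-.
by apply: eq_bigr => l _; rewrite !mxE.
Qed.

(** By Gaussian elimination [A] is [L *m pid_mx r *m U] with [L] and [U]
    invertible; the first [k] rows of the inverse of [L] select rows of [U]. *)
Lemma row_free_mull m n k (A : 'M[R]_(m, n)) : (k <= \rank A)%N ->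
  exists V : 'M[R]_(k, m), row_free (V *m A).
Proof.
move=> kA; exists (pid_mx k *m invmx (col_ebase A)).
rewrite -{2}(mulmx_ebase A) !mulmxA mulmxKV ?col_ebase_unit //.
rewrite mul_pid_mx /row_free mxrankMfree ?row_free_unit ?row_ebase_unit //.
have kn : (k <= n)%N by exact: leq_trans kA (rank_leq_col _).
have km : (k <= m)%N by exact: leq_trans kA (rank_leq_row _).
by rewrite (minn_idPl kA) (minn_idPr km) rank_pid_mx.
Qed.

Lemma affine_eq_linear p q (A B : 'M[R]_(p, q)) a b :
  (forall x : 'cV[R]_q, A *m x + a = B *m x + b) -> A = B.
Proof.
move=> E; have ab : a = b by have := E 0; rewrite !mulmx0 !add0r.
apply: trmx_inj; apply/row_matrixP => j; rewrite -!tr_col !colE; congr (_^T).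
by apply: (addIr a); rewrite E ab.
Qed.

End linear_algebra.

(** * Null sets of product measures *)

Lemma measurable_preimage (d1 d2 : measure_display) (T1 : measurableType d1)
   (T2 : measurableType d2) (f : T1 -> T2) (A : set T2) :
  measurable_fun setT f -> measurable A -> measurable (f @^-1` A).
Proof. by move=> mf mA; rewrite -[X in measurable X]setTI; exact: mf. Qed.

Lemma null_ae (R : realType) (d : measure_display) (T : measurableType d)
    (m : {measure set T -> \bar R}) (A : set T) : measurable A -> m A = 0%E ->
  {ae m, forall x, ~ A x}.
Proof. by move=> mA A0; exists A; split => // x /= /contrapT. Qed.

Lemma ae_null (R : realType) (d : measure_display) (T : measurableType d)
    (m : {measure set T -> \bar R}) (A : set T) : measurable A ->
  {ae m, forall x, ~ A x} -> m A = 0%E.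
Proof.
move=> mA H; apply/negligibleP => //; apply: negligibleS H => x Ax /=.
by move/(_ Ax).
Qed.

Lemma ge0_integral_eq0P (d : measure_display) (T : measurableType d)
    (R : realType) (m : {measure set T -> \bar R}) (f : T -> \bar R) :
  measurable_fun setT f -> (forall x, 0 <= f x)%E ->
  (\int[m]_x f x = 0)%E <-> {ae m, forall x, f x = 0%E}.
Proof.
move=> mf f0.
have := ae_eq_integral_abs m measurableT mf.
rewrite (_ : \int[m]_x `|f x| = \int[m]_x f x)%E; last first.
  by apply: eq_integral => x _; rewrite gee0_abs.
move=> ->; split; apply: filterS => x; first exact.
by move=> ? _.
Qed.

Section product_null.
Context (disp1 disp2 : measure_display) (T1 : measurableType disp1)
  (T2 : measurableType disp2) (R : realType).
Context (m1 : {sigma_finite_measure set T1 -> \bar R})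
  (m2 : {sigma_finite_measure set T2 -> \bar R}).

Lemma prod_null_xsection (N : set (T1 * T2)) : measurable N ->
  ((m1 \x m2) N = 0)%E <-> {ae m1, forall x, m2 (xsection N x) = 0%E}.
Proof.
move=> mN; rewrite /product_measure1.
apply: ge0_integral_eq0P => //.
exact: measurable_fun_xsection.
Qed.

Lemma prod_null_ysection (N : set (T1 * T2)) : measurable N ->
  ((m1 \x m2) N = 0)%E <-> {ae m2, forall y, m1 (ysection N y) = 0%E}.
Proof.
move=> mN; have -> : ((m1 \x m2) N = (m1 \x^ m2) N)%E.
  apply: (@product_measure_unique _ _ _ _ _ m1 m2 (m1 \x^ m2)%E) => //.
  by move=> A B mA mB; exact: product_measure2E.
rewrite /product_measure2.
apply: ge0_integral_eq0P => //.
exact: measurable_fun_ysection.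
Qed.

End product_null.

Section power_null.
Context (d1 : measure_display) (T1 : measurableType d1) (R : realType).
Context (m : {sigma_finite_measure set T1 -> \bar R}).

Lemma power_null_tail n (N : set (n.+1.-tuple T1)) : measurable N ->
  (power_measure m n.+1 N = 0)%E <->
  {ae power_measure m n, forall t, m [set x | N (tuple_cons (x, t))] = 0%E}.
Proof.
move=> mN; rewrite /= /cons_measure /pushforward.
have mN' := measurable_preimage (@measurable_tuple_cons _ T1 n) mN.
rewrite prod_null_ysection //.
have E t : ysection (tuple_cons @^-1` N) t = [set x | N (tuple_cons (x, t))].
  by apply/seteqP; split => x; rewrite /ysection /= in_setE.
by split; apply: filterS => t; rewrite E.
Qed.

Lemma power_null_head n (N : set (n.+1.-tuple T1)) : measurable N ->
  (power_measure m n.+1 N = 0)%E <->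
  {ae m, forall x, power_measure m n [set t | N (tuple_cons (x, t))] = 0%E}.
Proof.
move=> mN; rewrite /= /cons_measure /pushforward.
have mN' := measurable_preimage (@measurable_tuple_cons _ T1 n) mN.
rewrite prod_null_xsection //.
have E x : xsection (tuple_cons @^-1` N) x = [set t | N (tuple_cons (x, t))].
  by apply/seteqP; split => t; rewrite /xsection /= in_setE.
by split; apply: filterS => x; rewrite E.
Qed.

End power_null.

Section translation.
Context (R : realType).
Local Notation mR := (measurableTypeR R).

Lemma measurable_addl (t : R) :
  measurable_fun setT ((fun x => t + x) : mR -> mR).
Proof.
apply: continuous_measurable_fun => x.
by apply: cvgD; [exact: cvg_cst|exact: cvg_id].
Qed.

Lemma lebesgue_addl (t : R) (A : set mR) : measurable A ->
  pushforward lebesgue_measure ((fun x => t + x) : mR -> mR) A =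
  lebesgue_measure A.
Proof.
move=> mA; apply/esym/lebesgue_measure_unique => //=.
  exact: measurable_addl.
move=> _ X [[a b] _ <-] /=.
rewrite /pushforward (_ : _ @^-1` _ = [set` `]a - t, b - t]]).
  rewrite !lebesgue_measure_itv /= !lte_fin ltrD2r; case: ifP => // _.
  by congr (_ %:E); rewrite opprB addrA subrK.
by apply/seteqP; split => x /=; rewrite !in_itv /= ltrBlDl lerBrDl.
Qed.

Definition tuple_add n (v t : n.-tuple R) : n.-tuple R :=
  [tuple tnth v i + tnth t i | i < n].

Lemma measurable_tuple_add n (v : n.-tuple R) :
  measurable_fun setT (tuple_add v : n.-tuple mR -> n.-tuple mR).
Proof.
apply/measurable_fun_tnthP => i.
rewrite (_ : _ \o _ = (fun x => tnth v i + x) \o (@tnth n mR ^~ i)); last first.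
  by apply/funext => t /=; rewrite tnth_mktuple.
by apply: measurableT_comp; [exact: measurable_addl|exact: measurable_tnth].
Qed.

Lemma tuple_add_cons n (v0 x : mR) (v t : n.-tuple mR) :
  tuple_add (tuple_cons (v0, v)) (tuple_cons (x, t)) =
  tuple_cons ((v0 + x : mR), tuple_add v t).
Proof.
apply/eq_from_tnth => i; rewrite tnth_mktuple.
by case: (unliftP ord0 i) => [j ->|->]; rewrite ?tnthS ?tnth0 ?tnth_mktuple.
Qed.

(** Fubini reduces the invariance to the real line, one coordinate at a time:
    the first coordinate is moved for a fixed tail, then the tail for a fixed
    first coordinate. *)
Lemma translation_null n (v : n.-tuple R) (N : set (n.-tuple mR)) :
  measurable N -> power_measure (@lebesgue_measure R) n N = 0%E ->
  power_measure (@lebesgue_measure R) n (tuple_add v @^-1` N) = 0%E.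
Proof.
elim: n v N => [|n IH] v N mN.
  rewrite (_ : tuple_add v @^-1` N = N) //; apply/seteqP.
  by split => t; rewrite /= (tuple0 t) (tuple0 (tuple_add _ _)).
have mcl (t : n.-tuple mR) :
    measurable_fun setT (fun x : mR => tuple_cons (x, t)).
  apply: (measurableT_comp (@measurable_tuple_cons _ mR n)).
  exact: pair2_measurable.
have mcr (x : mR) :
    measurable_fun setT (fun t : n.-tuple mR => tuple_cons (x, t)).
  apply: (measurableT_comp (@measurable_tuple_cons _ mR n)).
  exact: pair1_measurable.
have [v0 [v' ->]] : exists v0 v', v = tuple_cons (v0, v').
  by case/tupleP: v => v0 v'; exists v0, v'; apply/val_inj.
pose z : n.-tuple R := [tuple 0 | _ < n].
have zD (u : n.-tuple R) : tuple_add z u = u.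
  by apply/eq_from_tnth => i; rewrite !tnth_mktuple add0r.
have mt := measurable_preimage (measurable_tuple_add _) mN.
move=> /(power_null_tail _ mN) H.
have : power_measure (@lebesgue_measure R) n.+1
    (tuple_add (tuple_cons (v0 : mR, z)) @^-1` N) = 0%E.
  apply/power_null_tail; first exact: mt.
  apply: filterS H => t <-.
  rewrite -[RHS](lebesgue_addl v0 (measurable_preimage (mcl t) mN)).
  congr (lebesgue_measure _); apply/seteqP.
  by split => x /=; rewrite tuple_add_cons zD.
move=> /(power_null_head _ (mt _)) {}H; apply/power_null_head; first exact: mt.
apply: filterS H => x; set A := [set t | _] => A0.
rewrite -(IH v' A _ A0); last exact: measurable_preimage (mcr x) (mt _).
congr (power_measure _ _ _); apply/seteqP.
by split => t /=; rewrite /A /= !tuple_add_cons zD.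
Qed.

End translation.

(** * Measurability of matrix operations *)

Lemma measurable_zero_set (R : realType) (d : measure_display)
    (T : measurableType d) (f : T -> R) :
  measurable_fun setT f -> measurable [set x | f x = 0].
Proof.
move=> mf; rewrite (_ : [set x | _] = f @^-1` [set 0]) //.
by apply: measurable_preimage => //; exact: measurable_set1.
Qed.

Lemma measurable_tuple_fun (d d' : measure_display) (T : measurableType d)
    (T' : measurableType d') m (f : 'I_m -> T -> T') :
  (forall i, measurable_fun setT (f i)) ->
  measurable_fun setT (fun x => [tuple f i x | i < m]).
Proof.
move=> mf; apply/measurable_fun_tnthP => i.
by rewrite (_ : _ \o _ = f i) //; apply/funext => x /=; rewrite tnth_mktuple.
Qed.

Section measurable_matrix_operations.
Context (R : realType) (d : measure_display) (T : measurableType d).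

Lemma measurable_inv : measurable_fun setT (fun x : R => x^-1).
Proof.
have -> : [set: R] = [set x | x != 0] `|` [set 0].
  by apply/seteqP; split => x //= _; case: (eqVneq x 0); [right|left].
have oU : open [set x : R | x != 0] by exact: open_neq.
apply/measurable_funU; [exact: open_measurable|exact: measurable_set1|split].
  apply: open_continuous_measurable_fun => // x.
  by rewrite in_setE /= => x0; exact: inv_continuous.
exact: measurable_fun_set1.
Qed.

Lemma measurable_entry m n (i : 'I_m) (j : 'I_n) :
  measurable_fun setT (fun M : 'M[R]_(m, n) => M i j).
Proof.
move=> _ A mA; rewrite setTI; apply: sub_sigma_algebra.
by exists (i, j) => //; exists A => //; rewrite setTI.
Qed.

Lemma measurable_mxP m n (f : T -> 'M[R]_(m, n)) :
  (forall i j, measurable_fun setT (fun x => f x i j)) -> measurable_fun setT f.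
Proof.
move=> mf; apply: measurability => // _ [_ [[i j] _ [A mA <-]] <-].
by rewrite !setTI -comp_preimage; apply: measurable_preimage mA; exact: mf.
Qed.

Lemma measurable_mulmx m n p (f : T -> 'M[R]_(m, n)) (g : T -> 'M[R]_(n, p)) :
  measurable_fun setT f -> measurable_fun setT g ->
  measurable_fun setT (fun x => f x *m g x).
Proof.
move=> mf mg; apply: measurable_mxP => i j.
under eq_fun do rewrite mxE.
apply: measurable_sum => k; apply: measurable_funM.
  exact: (measurableT_comp (measurable_entry _ _) mf).
exact: (measurableT_comp (measurable_entry _ _) mg).
Qed.

Lemma measurable_addmx m n (f g : T -> 'M[R]_(m, n)) :
  measurable_fun setT f -> measurable_fun setT g ->
  measurable_fun setT (fun x => f x + g x).
Proof.
move=> mf mg; apply: measurable_mxP => i j.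
under eq_fun do rewrite mxE.
apply: measurable_funD.
  exact: (measurableT_comp (measurable_entry _ _) mf).
exact: (measurableT_comp (measurable_entry _ _) mg).
Qed.

Lemma measurable_scalemx m n (a : T -> R) (f : T -> 'M[R]_(m, n)) :
  measurable_fun setT a -> measurable_fun setT f ->
  measurable_fun setT (fun x => a x *: f x).
Proof.
move=> ma mf; apply: measurable_mxP => i j.
under eq_fun do rewrite mxE.
apply: measurable_funM => //.
exact: (measurableT_comp (measurable_entry _ _) mf).
Qed.

Lemma measurable_lsubmx m n1 n2 (f : T -> 'M[R]_(m, n1 + n2)) :
  measurable_fun setT f -> measurable_fun setT (fun x => lsubmx (f x)).
Proof.
move=> mf; apply: measurable_mxP => i j.
under eq_fun do rewrite mxE.
exact: (measurableT_comp (measurable_entry _ _) mf).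
Qed.

Lemma measurable_rsubmx m n1 n2 (f : T -> 'M[R]_(m, n1 + n2)) :
  measurable_fun setT f -> measurable_fun setT (fun x => rsubmx (f x)).
Proof.
move=> mf; apply: measurable_mxP => i j.
under eq_fun do rewrite mxE.
exact: (measurableT_comp (measurable_entry _ _) mf).
Qed.

Lemma measurable_trmx m n (f : T -> 'M[R]_(m, n)) :
  measurable_fun setT f -> measurable_fun setT (fun x => (f x)^T).
Proof.
move=> mf; apply: measurable_mxP => i j.
under eq_fun do rewrite mxE.
exact: (measurableT_comp (measurable_entry _ _) mf).
Qed.

Lemma measurable_col_mx m1 m2 n (f : T -> 'M[R]_(m1, n))
    (g : T -> 'M[R]_(m2, n)) :
  measurable_fun setT f -> measurable_fun setT g ->
  measurable_fun setT (fun x => col_mx (f x) (g x)).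
Proof.
move=> mf mg; apply: measurable_mxP => i j.
under eq_fun do rewrite mxE.
case: (fintype.split i) => k; exact: (measurableT_comp (measurable_entry _ _)).
Qed.

Lemma measurable_det n (f : T -> 'M[R]_n) :
  measurable_fun setT f -> measurable_fun setT (fun x => \det (f x)).
Proof.
move=> mf; rewrite /determinant; apply: measurable_sum => s.
apply: measurable_funM; first exact: measurable_cst.
apply: measurable_prod => i _.
exact: (measurableT_comp (measurable_entry _ _) mf).
Qed.

Lemma measurable_deflate m (P : T -> 'M[R]_m) (x : T -> 'cV[R]_m) :
  measurable_fun setT P -> measurable_fun setT x ->
  measurable_fun setT (fun t => deflate (P t) (x t)).
Proof.
move=> mP mx; rewrite /deflate /sqnorm.
have mu := measurable_mulmx mP mx; have muT := measurable_trmx mu.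
under eq_fun do rewrite -scaleN1r.
apply: measurable_addmx => //.
apply: measurable_scalemx; first exact: measurable_cst.
apply: measurable_scalemx.
  apply: (measurableT_comp measurable_inv).
  exact: (measurableT_comp (measurable_entry _ _) (measurable_mulmx muT mu)).
exact: measurable_mulmx.
Qed.

Lemma measurable_left_ker_proj m n (x : 'I_n -> T -> 'cV[R]_m) :
  (forall i, measurable_fun setT (x i)) ->
  measurable_fun setT (fun t => left_ker_proj [seq x i t | i <- enum 'I_n]).
Proof.
move=> mx; rewrite /left_ker_proj.
suff H s (P : T -> 'M[R]_m) : measurable_fun setT P ->
    measurable_fun setT
      (fun t => foldl (@deflate R m) (P t) [seq x i t | i <- s]).
  by apply: H; exact: measurable_cst.
elim: s P => //= i s IH P mP.
by apply: (IH (fun t => deflate (P t) (x i t))); exact: measurable_deflate.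
Qed.

End measurable_matrix_operations.

(** * Draws in general position *)

Section general_position.
Context (R : realType).
Local Notation mR := (measurableTypeR R).
Local Notation leb := (@lebesgue_measure R).

(** If the first coefficient is nonzero, every section along the first
    coordinate is a single point; otherwise the equation is about the tail. *)
Lemma affine_tuple_null D (a0 : R) (a : 'rV[R]_D) : (a0 != 0) || (a != 0) ->
  power_measure leb D [set t | a0 + \sum_i a 0 i * tnth t i = 0] = 0%E.
Proof.
elim: D a0 a => [|D IH] a0 a.
  rewrite [a]thinmx0 eqxx orbF => a0n0.
  rewrite (_ : [set t | _] = set0) ?measure0 //; apply/seteqP; split => t //=.
  by rewrite big_ord0 addr0 => /eqP; rewrite (negPf a0n0).
move=> nz.
have mA :
    measurable [set t : D.+1.-tuple mR | a0 + \sum_i a 0 i * tnth t i = 0].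
  apply: measurable_zero_set; apply: measurable_funD => //.
  apply: measurable_sum => i; apply: measurable_funM => //.
  exact: measurable_tnth.
have E x t : a0 + \sum_i a 0 i * tnth (tuple_cons ((x : mR), t)) i =
    a0 + a 0 ord0 * x + \sum_i (col' ord0 a) 0 i * tnth t i.
  rewrite big_ord_recl tnth0 addrA; congr (_ + _); apply: eq_bigr => i _.
  by rewrite tnthS mxE.
have [a00|a0n] := eqVneq (a 0 ord0) 0.
  apply/power_null_head => //; apply: aeW => x.
  rewrite -[RHS](IH a0 (col' ord0 a)).
    by congr (power_measure _ _ _); apply/seteqP; split => t /=;
      rewrite E a00 mul0r addr0.
  move: nz; have [//|_ /=] := boolP (a0 != 0).
  apply: contra_neq => a'0; apply/rowP => i; rewrite mxE.
  case: (unliftP ord0 i) => [j ->|-> //].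
  by have := congr1 (fun M : 'rV_D => M 0 j) a'0; rewrite !mxE.
apply/power_null_tail => //; apply: aeW => t.
set s := \sum_i (col' ord0 a) 0 i * tnth t i.
rewrite -[RHS](lebesgue_measure_set1 (- (a0 + s) / a 0 ord0)).
congr (lebesgue_measure _); apply/seteqP; split => x /=; rewrite E -/s.
  move=> /eqP; rewrite addrAC addr_eq0 => /eqP ->.
  by rewrite opprK mulrAC divff ?mul1r.
by move=> ->; rewrite mulrCA divff // mulr1 addrAC subrr.
Qed.

Definition homog D (w : 'cV[R]_D) : 'cV[R]_(1 + D) := col_mx 1%:M w.

Lemma measurable_homog D : measurable_fun setT (@homog D).
Proof.
by apply: measurable_col_mx; [exact: measurable_cst|exact: measurable_id].
Qed.

Lemma hyperplane_null D (c : 'rV[R]_(1 + D)) : c != 0 ->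
  lebesgue_measure_cV [set w : 'cV[R]_D | (c *m homog w) 0 0 = 0] = 0%E.
Proof.
move=> c0; rewrite /lebesgue_measure_cV /pushforward.
rewrite -(@affine_tuple_null D (c 0 0) (rsubmx c)).
  congr (power_measure _ _ _).
  suff E t : (c *m homog (col_of_tuple t)) 0 0 =
      c 0 0 + \sum_i (rsubmx c) 0 i * tnth t i.
    by apply/seteqP; split => t /=; rewrite E.
  rewrite -[c in LHS]hsubmxK mul_row_col mulmx1 mxE; congr (_ + _).
    by rewrite mxE; congr (c _ _); apply/val_inj.
  by rewrite mxE; apply: eq_bigr => i _; rewrite !mxE.
move: c0; have [//|/negPn/eqP c00 /=] := boolP (c 0 0 != 0).
apply: contra_neq => r0; rewrite -[c]hsubmxK r0 (_ : lsubmx c = 0) ?row_mx0 //.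
by apply/matrixP => i j; rewrite !mxE !ord1 -c00; congr (c _ _); exact/val_inj.
Qed.

(** Only the first [m] of the [n] draws are kept, so that [V *m homog_mx h w]
    below is a square matrix. *)
Definition homog_mx D n m (h : (m <= n)%N) (w : n.-tuple 'cV[R]_D) :
    'M[R]_(1 + D, m) :=
  \matrix_(i, j) homog (tnth w (widen_ord h j)) i 0.

Lemma measurable_homog_mx D n m (h : (m <= n)%N) :
  measurable_fun setT (fun w : n.-tuple 'cV[R]_D => homog_mx h w).
Proof.
apply: measurable_mxP => i j; under eq_fun do rewrite mxE.
apply: (measurableT_comp (measurable_entry _ _)).
by apply: (measurableT_comp (@measurable_homog D)); exact: measurable_tnth.
Qed.

(** Expanded along its first column, the determinant is an affine function of
    the first draw [x], with coefficients [c *m V], where [c] collects the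
    cofactors, which depend on the other draws [t].  By induction the first
    cofactor is almost surely nonzero; then [c *m V != 0] because [V] has
    independent rows, and [x] almost surely avoids a hyperplane. *)
Lemma generic_det_null D (P : {sigma_finite_measure set 'cV[R]_D -> \bar R}) :
  P `<< @lebesgue_measure_cV R D ->
  forall n m (h : (m <= n)%N) (V : 'M[R]_(m, 1 + D)), row_free V ->
  power_measure P n [set w | \det (V *m homog_mx h w) = 0] = 0%E.
Proof.
move=> /null_content_dominatesP Pac; elim=> [|n IH] [|m] h V Vfree //.
- rewrite (_ : [set w | _] = set0) ?measure0 //; apply/seteqP; split => t //=.
  by rewrite det_mx00 => /eqP; rewrite oner_eq0.
- rewrite (_ : [set w | _] = set0) ?measure0 //; apply/seteqP; split => t //=.
  by rewrite det_mx00 => /eqP; rewrite oner_eq0.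
have md p q (h' : (p <= q)%N) (W : 'M[R]_(p, 1 + D)) :
    measurable [set w : q.-tuple 'cV[R]_D | \det (W *m homog_mx h' w) = 0].
  apply: measurable_zero_set; apply: measurable_det.
  apply: measurable_mulmx; first exact: measurable_cst.
  exact: measurable_homog_mx.
have h' : (m <= n)%N by [].
have := null_ae (md _ _ h' _) (IH m h' _ (row_free_row' ord0 Vfree)).
move=> H; apply/power_null_tail; first exact: md.
apply: filterS H => t /= /eqP d0.
pose c : 'rV[R]_m.+1 := \row_i ((-1) ^+ i * \det (row' i (V *m homog_mx h' t))).
have E x : \det (V *m homog_mx h (tuple_cons (x, t))) = (c *m V *m homog x) 0 0.
  rewrite /c; set M := homog_mx h _; set M' := homog_mx h' t.
  have MS l k : M l (lift ord0 k) = M' l k.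
    rewrite /M /M' [LHS]mxE [RHS]mxE; congr (homog _ _ _).
    rewrite (_ : widen_ord h _ = lift ord0 (widen_ord h' k)) ?tnthS //.
    exact/val_inj.
  have M0 l : M l ord0 = homog x l 0.
    by rewrite /M [LHS]mxE (_ : widen_ord h _ = ord0) //; exact/val_inj.
  move: M M' (homog x) MS M0 => M M' y MS M0.
  rewrite (expand_det_col _ ord0) -mulmxA mxE; apply: eq_bigr => i _.
  rewrite /cofactor addn0 mulrC; congr (_ * _).
    rewrite mxE; congr (_ * \det _); apply/matrixP => j k; rewrite !mxE.
    by apply: eq_bigr => l _; rewrite MS.
  by rewrite !mxE; apply: eq_bigr => l _; rewrite M0.
rewrite (_ : [set x | _] = [set x | (c *m V *m homog x) 0 0 = 0]); last first.
  by apply/seteqP; split => x /=; rewrite E.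
apply: Pac; last first.
  apply: hyperplane_null; rewrite mulmx_free_eq0 //.
  apply: contra_neq d0 => c0.
  have := congr1 (fun M : 'rV_m.+1 => M 0 ord0) c0.
  rewrite !mxE expr0 mul1r => <-.
  congr (\det _); apply/matrixP => j k; rewrite !mxE.
  by apply: eq_bigr => l _; rewrite !mxE.
apply: measurable_zero_set; apply: (measurableT_comp (measurable_entry _ _)).
by apply: measurable_mulmx; [exact: measurable_cst|exact: measurable_homog].
Qed.

Lemma generic_det_ae D (P : {sigma_finite_measure set 'cV[R]_D -> \bar R}) :
  P `<< @lebesgue_measure_cV R D ->
  forall n m (h : (m <= n)%N) (V : 'M[R]_(m, 1 + D)), row_free V ->
  {ae power_measure P n, forall w, \det (V *m homog_mx h w) <> 0}.
Proof.
move=> Pac n m h V Vfree; apply: null_ae (generic_det_null Pac h Vfree).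
apply: measurable_zero_set; apply: measurable_det.
by apply: measurable_mulmx; [exact: measurable_cst|exact: measurable_homog_mx].
Qed.

(** A basis of the row space of [M] has at most [n] rows, so that its product
    with the draws contains an invertible square matrix. *)
Lemma generic_left_kernel D
    (P : {sigma_finite_measure set 'cV[R]_D -> \bar R}) :
  P `<< @lebesgue_measure_cV R D ->
  forall n p (M : 'M[R]_(p, 1 + D)), (p <= n)%N ->
  {ae power_measure P n, forall w, forall a : 'rV[R]_p,
    (forall j, a *m (M *m homog (tnth w j)) = 0) -> a *m M = 0}.
Proof.
move=> Pac n p M pn; have h := leq_trans (rank_leq_row M) pn.
have := generic_det_ae Pac h (row_base_free M).
apply: filterS => w /eqP d0 a aM.
have /submxP[c E] : (a *m M <= row_base M)%MS by rewrite eq_row_base submxMl.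
suff c0 : c = 0 by rewrite E c0 mul0mx.
have U : row_base M *m homog_mx h w \in unitmx by rewrite unitmxE unitfE.
suff aO : a *m M *m homog_mx h w = 0.
  by rewrite -(mulmxK U c) mulmxA -E aO mul0mx.
apply/rowP => j.
transitivity ((a *m M *m homog (tnth w (widen_ord h j))) 0 0); last first.
  by rewrite -mulmxA aM !mxE.
move: (a *m M) => b; rewrite [LHS]mxE [RHS]mxE; apply: eq_bigr => k _.
by congr (_ * _); exact: mxE.
Qed.

End general_position.

(** * Matching from enough samples *)

Section matching_from_samples.
Context (R : realType) (d1 d2 n : nat).

Definition stacked (s : @sample R d1 d2 n) (j : 'I_n) :
    'cV[R]_(1 + (d1 + d2)) :=
  col_mx 1%:M (col_mx (tnth s.1 j) (tnth s.2 j)).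

Definition match_proj (s : @sample R d1 d2 n) : 'M[R]_(1 + (d1 + d2)) :=
  left_ker_proj [seq stacked s j | j <- enum 'I_n].

(** A row [(b, a1, - a2)] of [K] annihilates [(1, x1, x2)] exactly when
    [a1 x1 + b = a2 x2]. *)
Definition split_matching (K : 'M[R]_(1 + (d1 + d2))) :
    matching R d1 d2 (d1 + d2) :=
  ((lsubmx (rsubmx K), lsubmx K), (- rsubmx (rsubmx K), 0)).

Definition decoder (s : @sample R d1 d2 n) : any_matching R d1 d2 :=
  existT (matching R d1 d2) (d1 + d2)%N (split_matching (match_proj s)).

Lemma measurable_decoder : measurable_fun setT decoder.
Proof.
move=> _ Y mY; rewrite setTI.
rewrite (_ : _ @^-1` _ = (split_matching \o match_proj) @^-1`
   (existT (matching R d1 d2) (d1 + d2)%N @^-1` Y)) //.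
apply: measurable_preimage; last exact: (mY (d1 + d2)%N).
have mK : measurable_fun setT match_proj.
  apply: (measurable_left_ker_proj (x := fun j s => stacked s j)) => j.
  apply: measurable_col_mx; first exact: measurable_cst.
  apply: measurable_col_mx; apply: measurableT_comp (measurable_tnth _) _.
    exact: measurable_fst.
  exact: measurable_snd.
apply: measurable_fun_pair; apply: measurable_fun_pair.
- by apply: measurable_lsubmx; apply: measurable_rsubmx.
- exact: measurable_lsubmx.
- under eq_fun do rewrite -scaleN1r.
  apply: measurable_scalemx; first exact: measurable_cst.
  by do 2 apply: measurable_rsubmx.
- exact: measurable_cst.
Qed.

Definition stacked_mx D (S1 : 'M[R]_(d1, D)) (mu1 : 'cV[R]_d1)
    (S2 : 'M[R]_(d2, D)) (mu2 : 'cV[R]_d2) : 'M[R]_(1 + (d1 + d2), 1 + D) :=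
  col_mx (row_mx 1%:M 0) (col_mx (row_mx mu1 S1) (row_mx mu2 S2)).

Lemma stacked_alm D S1 mu1 S2 mu2 (w : n.-tuple 'cV[R]_D) j :
  stacked (alm S1 mu1 S2 mu2 w) j =
  stacked_mx S1 mu1 S2 mu2 *m homog (tnth w j).
Proof.
rewrite /stacked /stacked_mx /homog !mul_col_mx !mul_row_col !mulmx1 mul0mx.
rewrite addr0.
by rewrite /alm !tnth_mktuple ![mu1 + _]addrC ![mu2 + _]addrC.
Qed.

(** A common element [v = a1 *m S1 = a2 *m S2] of the row spaces is a left
    kernel vector of [M], once completed by the right constant; since [K] fixes
    it, [a1] is a combination of the rows of [A1], so that [v] is in the row
    space of [A1 *m S1]. *)
Lemma split_matching_exact D S1 mu1 S2 mu2 (K : 'M[R]_(1 + (d1 + d2))) :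
  let M := @stacked_mx D S1 mu1 S2 mu2 in
  K *m M = 0 -> (forall a : 'rV_(1 + (d1 + d2)), a *m M = 0 -> a *m K = a) ->
  exact_matching S1 mu1 S2 mu2
    (existT (matching R d1 d2) (d1 + d2)%N (split_matching K)).
Proof.
move=> M KM fixK /=.
set c := lsubmx K; set A1 := lsubmx (rsubmx K); set A2 := rsubmx (rsubmx K).
have KE : K = row_mx c (row_mx A1 A2) by rewrite !hsubmxK.
have ME p (b : 'cV_p) B1 B2 : row_mx b (row_mx B1 B2) *m M =
    row_mx (b + (B1 *m mu1 + B2 *m mu2)) (B1 *m S1 + B2 *m S2).
  rewrite /M /stacked_mx !mul_row_col !mul_mx_row mulmx1 mulmx0.
  by rewrite !add_row_mx add0r.
move: KM; rewrite KE ME -row_mx0 => /eq_row_mx[Kmu KS].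
have S12 : A1 *m S1 = - A2 *m S2.
  by apply/eqP; rewrite mulNmx -addr_eq0 KS.
have ker : (kermx (A1 *m S1)^T == kermx S1^T + kermx S2^T)%MS.
  apply: ker_meet; first exact: submxMl.
    by rewrite S12 submxMl.
  move=> v /submxP[a1 v1] /submxP[a2 v2].
  pose a := row_mx (- (a1 *m mu1 - a2 *m mu2)) (row_mx a1 (- a2)).
  have aM : a *m M = 0.
    by rewrite ME !mulNmx -v1 -v2 !subrr addNr row_mx0.
  have /(congr1 rsubmx)/(congr1 lsubmx) := fixK _ aM.
  rewrite KE !mul_mx_row !row_mxKr !row_mxKl => aA1.
  by rewrite v1 -aA1 -mulmxA submxMl.
split; [move=> w|exact: ker|by rewrite -S12].
rewrite !mulmxDr addr0 !mulmxA S12 -!addrA; congr (_ + _).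
by apply/eqP; rewrite mulNmx -addr_eq0 addrAC addrC Kmu.
Qed.

Lemma exactly_matchable_of_many :
  (d1 + d2 + 1 <= n)%N -> exactly_matchable R d1 d2 n.
Proof.
rewrite addnC => hn; exists decoder; first exact: measurable_decoder.
move=> D P _ Pac S1 mu1 S2 mu2.
have := @generic_left_kernel R D P Pac n _ (stacked_mx S1 mu1 S2 mu2) hn.
apply: filterS => w H; apply: split_matching_exact.
  apply/row_matrixP => i; rewrite row_mul row0; apply: H => j.
  rewrite -stacked_alm -row_mul left_ker_proj_annihilates ?row0 //.
  by apply/mapP; exists j; rewrite ?mem_enum.
move=> a aM; apply: left_ker_proj_fixes => x /mapP[j _ ->].
by rewrite stacked_alm mulmxA aM mul0mx.
Qed.

End matching_from_samples.

(** * Impossibility with too few samples *)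

Lemma measurable_unit_box (R : realType) D :
  measurable [set v : 'cV[R]_D | forall i,
    (0 : 'cV[R]_D) i ord0 <= v i ord0 <= (const_mx 1 : 'cV[R]_D) i ord0].
Proof.
rewrite (_ : [set v | _] = \bigcap_(i in setT)
    ((fun v : 'cV[R]_D => v i ord0) @^-1` [set` `[0, 1]])).
  apply: fin_bigcap_measurable => // i _; apply: measurable_preimage.
    exact: measurable_entry.
  exact: measurable_itv.
apply/seteqP; split => v /= H i; have := H i; rewrite ?in_itv /= !mxE //.
by apply.
Qed.

(** The uniform law on the unit cube. *)
Lemma exists_abs_continuous (R : realType) D :
  exists P : probability 'cV[R]_D R, P `<< @lebesgue_measure_cV R D.
Proof.
have mB := @measurable_unit_box R D; set B := [set v | _] in mB.
pose mu := mrestr (@lebesgue_measure_cV R D) mB.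
have muT : mu setT = 1%E.
  rewrite /mu /mrestr setTI lebesgue_measure_cV_box; last first.
    by move=> i; rewrite !mxE ler01.
  by rewrite big1 // => i _; rewrite !mxE subr0.
pose P : probability 'cV[R]_D R := HB.pack_for (probability 'cV[R]_D R) mu
  (Measure_isProbability.Build _ _ _ mu muT).
exists P; apply/null_content_dominatesP => A mA A0.
apply: (subset_measure0 _ _ _ A0) => //.
exact: measurableI.
Qed.

Lemma power_probability_setT (R : realType) (d : measure_display)
    (T : measurableType d) (P : probability T R) n :
  power_measure P n setT = 1%E.
Proof.
rewrite (_ : setT = [set t | forall i, setT (tnth t i)]); last first.
  by apply/seteqP; split.
rewrite (@power_measure_box _ _ _ P n (fun _ => setT)) // big1 // => i _.
exact: probability_setT.
Qed.

Lemma power_lebesgue_setT (R : realType) n :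
  power_measure (@lebesgue_measure R) n setT <> 0%E.
Proof.
move=> T0; pose A (i : 'I_n) : set (measurableTypeR R) := [set` `[(0 : R), 1]].
have : power_measure (@lebesgue_measure R) n
    [set t | forall i, A i (tnth t i)] = 0%E.
  apply: (subset_measure0 _ _ _ T0) => //.
  rewrite (_ : [set t | _] = \bigcap_(i in setT) ((@tnth _ _ ^~ i) @^-1` A i)).
    apply: fin_bigcap_measurable => // i _; apply: measurable_preimage.
      exact: measurable_tnth.
    exact: measurable_itv.
  by apply/seteqP; split => t /= H i; [move=> _; exact: H|exact: (H i I)].
rewrite power_measure_box; last by move=> i; exact: measurable_itv.
rewrite big1 => [/eqP|i _]; first by rewrite onee_eq0.
etransitivity; first exact: (lebesgue_measure_itv `[(0 : R), 1]).
by rewrite /= lte_fin ltr01 oppr0 adde0.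
Qed.

Section tilted_models.
Context (R : realType) (d1 d2 : nat) (i2 : 'I_d2).

Definition view1 : 'M[R]_(d1, d1 + d2) := row_mx 1%:M 0.
Definition view2 : 'M[R]_(d2, d1 + d2) := row_mx 0 1%:M.
Definition axis : 'cV[R]_d2 := delta_mx i2 0.
Definition axis_coord : 'rV[R]_(d1 + d2) := axis^T *m view2.
Definition drop_coord : 'M[R]_(d1 + d2) := 1%:M - axis_coord^T *m axis_coord.

Let view11 : view1 *m view1^T = 1%:M.
Proof.
by rewrite /view1 tr_row_mx mul_row_col trmx1 trmx0 mulmx1 mulmx0 addr0.
Qed.

Let view12 : view1 *m view2^T = 0.
Proof.
by rewrite /view1 /view2 tr_row_mx mul_row_col trmx1 trmx0 mulmx0 mul0mx addr0.
Qed.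

Let view21 : view2 *m view1^T = 0.
Proof.
by rewrite /view1 /view2 tr_row_mx mul_row_col trmx1 trmx0 mulmx0 mul0mx addr0.
Qed.

Let view22 : view2 *m view2^T = 1%:M.
Proof.
by rewrite /view2 tr_row_mx mul_row_col trmx1 trmx0 mulmx1 mulmx0 add0r.
Qed.

Let viewD : view1^T *m view1 + view2^T *m view2 = 1%:M.
Proof.
rewrite /view1 /view2 !tr_row_mx !mul_col_row !trmx1 !trmx0.
rewrite !(mulmx1, mul0mx, mulmx0) add_block_mx !addr0 !add0r.
by rewrite -scalar_mx_block.
Qed.

Let axis1 : axis^T *m axis = 1%:M.
Proof.
rewrite /axis trmx_delta mul_delta_mx; apply/matrixP => i j.
by rewrite !mxE !ord1 eqxx.
Qed.

Let drop_view1 : drop_coord *m view1^T = view1^T.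
Proof.
rewrite /drop_coord mulmxBl mul1mx -mulmxA /axis_coord -mulmxA view21.
by rewrite !mulmx0 subr0.
Qed.

Let coord1 : axis_coord *m axis_coord^T = 1%:M.
Proof.
rewrite /axis_coord trmx_mul trmxK mulmxA -(mulmxA axis^T) view22 mulmx1.
exact: axis1.
Qed.

Let drop_coord0 : drop_coord *m axis_coord^T = 0.
Proof. by rewrite /drop_coord mulmxBl mul1mx -mulmxA coord1 mulmx1 subrr. Qed.

Definition flat_view : 'M[R]_(d2, d1 + d2) := view2 - axis *m axis_coord.

(** The linear form [r *m drop_coord], added to the row [i2], vanishes on the
    coordinate vector number [i2] of the second block, so that a tilt of
    [flat_view] still ignores this coordinate. *)
Definition tilt (J : 'M[R]_(d2, d1 + d2)) (r : 'rV[R]_(d1 + d2)) :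
    'M[R]_(d2, d1 + d2) :=
  J + axis *m (r *m drop_coord).

(** The two views together are invertible: the columns of [N] below are sent to
    a basis by [view1] and to [0] by [tilt view2 r]. *)
Lemma matching_tilt_view2 k (A1 : 'M[R]_(k, d1)) A2 r :
  A1 *m view1 = A2 *m tilt view2 r -> A1 = 0.
Proof.
move=> E; pose N := view1^T - view2^T *m (axis *m (r *m view1^T)).
have N1 : view1 *m N = 1%:M.
  by rewrite mulmxBr view11 (mulmxA view1) view12 mul0mx subr0.
have -> : A1 = A1 *m view1 *m N by rewrite -mulmxA N1 mulmx1.
have -> : A1 *m view1 *m N = A2 *m (tilt view2 r *m N) by rewrite E mulmxA.
suff -> : tilt view2 r *m N = 0 by rewrite mulmx0.
rewrite mulmxDl {1}/N mulmxBr view21 (mulmxA view2) view22 mul1mx sub0r.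
suff -> : axis *m (r *m drop_coord) *m N = axis *m (r *m view1^T).
  by rewrite addNr.
rewrite -!mulmxA; congr (_ *m (_ *m _)).
rewrite /N mulmxBr drop_view1 !mulmxA (_ : drop_coord *m _ *m _ = 0).
  by rewrite !mul0mx subr0.
by rewrite -[RHS]drop_coord0 /axis_coord trmx_mul trmxK mulmxA.
Qed.

(** The row vector [q] below depends on the first view only, and it is also the
    row [i2] of [tilt flat_view r] minus a combination of the other rows; being
    in both row spaces and nonzero, it confines both kernels to a hyperplane. *)
Lemma ker_tilt_flat_view r : r *m view1^T != 0 ->
  ~~ ((1%:M : 'M[R]_(d1 + d2)) <=
      kermx view1^T + kermx (tilt flat_view r)^T)%MS.
Proof.
apply: contra => /submxP[X E].
pose q := r *m view1^T *m view1.
have q1 : (q <= view1)%MS by exact: submxMl.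
have q2 : (q <= tilt flat_view r)%MS.
  have p0 : r *m drop_coord *m axis_coord^T = 0.
    by rewrite -mulmxA drop_coord0 mulmx0.
  have p1 : r *m drop_coord *m view1^T = r *m view1^T.
    by rewrite -mulmxA drop_view1.
  rewrite /tilt /flat_view /q -{}p1; move: (r *m drop_coord) p0 => p p0.
  apply/submxP; exists (axis^T - p *m view2^T).
  have pa : p *m view2^T *m axis = 0.
    by rewrite -mulmxA -[RHS]p0 /axis_coord trmx_mul trmxK.
  rewrite mulmxBl !mulmxDr !mulmxN !(mulmxA _ axis) axis1 pa !mul0mx !mul1mx.
  rewrite -/axis_coord subrr add0r oppr0 !addr0; apply/eqP.
  by rewrite eq_sym subr_eq -!mulmxA -mulmxDr viewD mulmx1.
have kq k (T : 'M[R]_(k, d1 + d2)) : (q <= T)%MS -> kermx T^T *m q^T = 0.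
  by case/submxP => Y ->; rewrite trmx_mul mulmxA mulmx_ker mul0mx.
have : (kermx view1^T + kermx (tilt flat_view r)^T)%MS *m q^T = 0.
  apply/eqP; rewrite -submx0; apply: submx_trans (submxMr _ _) _.
    by rewrite addsmxE; exact: submx_refl.
  by rewrite mul_col_mx !kq // col_mx0 submx0.
move=> W0; have : q^T = 0 by rewrite -[q^T]mul1mx E -mulmxA W0 mulmx0.
move=> /(congr1 trmx); rewrite trmxK trmx0 => q0.
by rewrite -[r *m _]mulmx1 -view11 mulmxA -/q q0 mul0mx.
Qed.

(** The affine function with coefficients [p] that is added to the coordinate
    [i2] takes the value [p *m coef_mx *m homog x] at [x]. *)
Definition coef_mx : 'M[R]_(1 + (d1 + d2)) := block_mx 1%:M 0 0 drop_coord.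

Lemma rank_coef_mx : (d1 + d2 <= \rank coef_mx)%N.
Proof.
pose s : 'rV[R]_(1 + (d1 + d2)) := row_mx 0 axis_coord.
have E : 1%:M = coef_mx + s^T *m s.
  rewrite /s tr_row_mx mul_col_row trmx0 !mul0mx !mulmx0 add_block_mx !addr0.
  by rewrite /drop_coord subrK -scalar_mx_block.
have := mxrank1 R (1 + (d1 + d2)); rewrite E => rE.
have rs : (\rank (s^T *m s) <= 1)%N.
  exact: leq_trans (mxrankM_maxr _ _) (rank_leq_row s).
have := leq_trans (mxrank_add coef_mx (s^T *m s)) (leq_add (leqnn _) rs).
by rewrite rE (addnC _ 1%N) leq_add2l.
Qed.

Context (n : nat) (i1 : 'I_d1).
Local Notation mR := (measurableTypeR R).
Local Notation d := (d1 + d2)%N.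
Local Notation draws := (n.-tuple 'cV[R]_d).
Local Notation params := ((1 + d).-tuple mR).
Local Notation leb := (power_measure (@lebesgue_measure R) (1 + d)).

Definition zero_first : set (any_matching R d1 d2) :=
  [set o | let: existT k ((A1, _), _) := o in A1 = 0].

Lemma measurable_zero_first : measurable zero_first.
Proof.
move=> k; rewrite (_ : _ @^-1` _ = \bigcap_(ij in setT)
   ((fun p : matching R d1 d2 k => p.1.1 ij.1 ij.2) @^-1` [set 0])).
  apply: fin_bigcap_measurable => // ij _; apply: measurable_preimage.
    apply: (measurableT_comp (measurable_entry _ _)).
    by apply: (measurableT_comp measurable_fst); exact: measurable_fst.
  exact: measurable_set1.
apply/seteqP; split => [[[A1 b1] [A2 b2]] /= H|[[A1 b1] [A2 b2]] /= H].
  by move=> ij _ /=; rewrite H mxE.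
by apply/matrixP => i j; rewrite mxE; exact: (H (i, j)).
Qed.

Definition param_row (t : params) : 'rV[R]_(1 + d) := \row_i tnth t i.

Definition tilted_alm (J : 'M[R]_(d2, d)) (w : n.-tuple 'cV[R]_d)
    (t : params) : @sample R d1 d2 n :=
  alm view1 0 (tilt J (rsubmx (param_row t)))
    (axis *m lsubmx (param_row t)) w.

Lemma measurable_tilted_alm J :
  measurable_fun setT (fun wt : draws * params => tilted_alm J wt.1 wt.2).
Proof.
have mw j : measurable_fun setT (fun wt : draws * params => tnth wt.1 j).
  exact: (measurableT_comp (measurable_tnth j) measurable_fst).
have mp : measurable_fun setT (fun wt : draws * params => param_row wt.2).
  apply: measurable_mxP => i j; under eq_fun do rewrite mxE.
  exact: (measurableT_comp (measurable_tnth j) measurable_snd).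
have mc p q (M : 'M[R]_(p, q)) :=
  @measurable_cst _ _ (draws * params)%type _ setT M.
apply: measurable_fun_pair; apply: measurable_tuple_fun => j.
  by apply: measurable_addmx; [apply: measurable_mulmx|].
apply: measurable_addmx.
  apply: measurable_mulmx => //; apply: measurable_addmx => //.
  do 2 (apply: measurable_mulmx => //); exact: measurable_rsubmx.
by apply: measurable_mulmx => //; exact: measurable_lsubmx.
Qed.

(** If the affine function with coefficients [t0] agrees with the coordinate
    that [flat_view] has lost, at the finitely many points drawn, then adding it
    to the parameters restores that coordinate in the data. *)
Lemma tilted_alm_shift w t0 t :
  (forall j, param_row t0 *m coef_mx *m homog (tnth w j) =
     axis_coord *m tnth w j) ->
  tilted_alm view2 w t = tilted_alm flat_view w (tuple_add t0 t).
Proof.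
move=> H.
have coefE (u : params) x : param_row u *m coef_mx *m homog x =
    lsubmx (param_row u) + rsubmx (param_row u) *m drop_coord *m x.
  rewrite -{1}[param_row u]hsubmxK /coef_mx mul_row_block !mulmx0 add0r addr0.
  by rewrite mulmx1 /homog mul_row_col mulmx1.
rewrite /tilted_alm /alm; congr (_, _).
apply: eq_from_tnth => j; rewrite !tnth_mktuple /tilt /flat_view.
have -> : param_row (tuple_add t0 t) = param_row t0 + param_row t.
  by apply/rowP => i; rewrite !mxE tnth_mktuple.
have := H j; rewrite {H} coefE.
move: (param_row t0) (param_row t) drop_coord => p0 p Q E.
rewrite !mulmxDl mulNmx -(mulmxA _ axis_coord) -E.
rewrite !linearD /= !mulmxDl !mulmxDr !mulmxDl !mulmxA -!addrA.
congr (_ + _).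
by rewrite addKr [X in _ = - _ + X]addrCA addKr.
Qed.

(** The linear part of almost every parameter involves the first view: this is
    what makes the tilts of [flat_view] satisfy [ker_tilt_flat_view]. *)
Lemma param_generic_ae :
  {ae leb, forall t, rsubmx (param_row t) *m view1^T != 0}.
Proof.
pose k : 'I_(1 + d) := rshift 1 (lshift d2 i1).
pose a : 'rV[R]_(1 + d) := delta_mx 0 k.
have a0 : a != 0.
  by apply/eqP => /rowP/(_ k); rewrite !mxE !eqxx => /eqP; rewrite oner_eq0.
have aE (t : params) : 0 + \sum_i a 0 i * tnth t i = tnth t k.
  rewrite add0r (bigD1 k) //= big1 ?addr0 => [|i ik]; rewrite mxE ?eqxx.
    by rewrite mul1r.
  by rewrite (negPf ik) mul0r.
have A0 := affine_tuple_null (a0 := 0) (a := a).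
rewrite eqxx a0 in A0; have {}A0 := A0 isT.
have mA : measurable [set t : params | 0 + \sum_i a 0 i * tnth t i = 0].
  rewrite (_ : [set t | _] = [set t : params | tnth t k = 0]).
    by apply: measurable_zero_set; exact: measurable_tnth.
  by apply/seteqP; split => t /=; rewrite aE.
have := null_ae mA A0; apply: filterS => t /=; rewrite aE => H.
apply/eqP; rewrite /view1 tr_row_mx trmx1 trmx0 => E; apply: H.
move: E; rewrite -[rsubmx _]hsubmxK mul_row_col mulmx1 mulmx0 addr0.
by move=> /rowP/(_ i1); rewrite !mxE.
Qed.

(** [n] points in general position of R^(1 + d) remain independent after the
    projection [coef_mx], whose rank is at least [d >= n], so that an affine
    function can be prescribed at them. *)
Lemma tilt_onto_ae (P : probability 'cV[R]_d R) :
  P `<< @lebesgue_measure_cV R d -> (n <= d)%N ->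
  {ae power_measure P n, forall w, exists t0, forall j,
    param_row t0 *m coef_mx *m homog (tnth w j) =
    axis_coord *m tnth w j}.
Proof.
move=> Pac nd.
have [V Vfree] := row_free_mull (leq_trans nd rank_coef_mx).
have := generic_det_ae Pac (leqnn n) Vfree; apply: filterS => w /eqP d0.
set M := _ *m homog_mx _ _ in d0.
have U : M \in unitmx by rewrite unitmxE unitfE.
pose y : 'rV[R]_n := \row_j (axis_coord *m tnth w j) 0 0.
exists [tuple (y *m invmx M *m V) 0 i | i < 1 + d] => j.
have -> : param_row [tuple (y *m invmx M *m V) 0 i | i < 1 + d] =
    y *m invmx M *m V.
  by apply/rowP => i; rewrite mxE tnth_mktuple.
have : y *m invmx M *m M = y by rewrite mulmxKV.
rewrite /M !mulmxA; move: (y *m _ *m _ *m _) => b /rowP/(_ j).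
rewrite [y 0 j]mxE => E.
apply/matrixP => i k; rewrite !ord1 -E [LHS]mxE [RHS]mxE.
apply: eq_bigr => l _; rewrite /homog_mx [in RHS]mxE.
by rewrite (_ : widen_ord _ _ = j) //; exact/val_inj.
Qed.

Section exact_decoder.
Context (dec : @sample R d1 d2 n -> any_matching R d1 d2)
  (P : probability 'cV[R]_d R) (mdec : measurable_fun setT dec)
  (dec_exact : forall S1 mu1 S2 mu2, {ae power_measure P n, forall w,
     exact_matching S1 mu1 S2 mu2 (dec (@alm R d1 d2 n d S1 mu1 S2 mu2 w))}).

Lemma tilted_alm_view2_ae t :
  {ae power_measure P n, forall w,
    zero_first (dec (tilted_alm view2 w t))}.
Proof.
have := dec_exact view1 0 (tilt view2 (rsubmx (param_row t)))
  (axis *m lsubmx (param_row t)).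
apply: filterS => w; rewrite /tilted_alm.
case: (dec _) => k [[A1 b1] [A2 b2]] [E _ _] /=.
apply: (@matching_tilt_view2 _ A1 A2 (rsubmx (param_row t))).
apply: affine_eq_linear => x; have := E x.
by rewrite addr0 mulmxDr !mulmxA -addrA; exact.
Qed.

Lemma tilted_alm_flat_view_ae t : rsubmx (param_row t) *m view1^T != 0 ->
  {ae power_measure P n, forall w,
    ~ zero_first (dec (tilted_alm flat_view w t))}.
Proof.
move=> t0.
have := dec_exact view1 0 (tilt flat_view (rsubmx (param_row t)))
  (axis *m lsubmx (param_row t)).
apply: filterS => w; rewrite /tilted_alm.
case: (dec _) => k [[A1 b1] [A2 b2]] [_ E _] /= A10; rewrite A10 in E.
have /negP := ker_tilt_flat_view t0; apply.
case/andP: E => E _; apply: submx_trans E; apply/sub_kermxP.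
by rewrite mul0mx trmx0 mulmx0.
Qed.

Lemma measurable_tilted_zero J :
  measurable [set wt : draws * params |
    zero_first (dec (tilted_alm J wt.1 wt.2))].
Proof.
apply: (measurable_preimage (measurableT_comp mdec (measurable_tilted_alm J))).
exact: measurable_zero_first.
Qed.

Lemma not_matchable_of_few : P `<< @lebesgue_measure_cV R d -> ~ (n <= d)%N.
Proof.
move=> Pac nd.
pose Z J :=
  [set wt : draws * params | zero_first (dec (tilted_alm J wt.1 wt.2))].
have mZ J : measurable (Z J) by exact: measurable_tilted_zero.
pose B1 := ~` Z view2; pose B0 := Z flat_view.
have mB1 : measurable B1 by apply: measurableC; exact: mZ.
have mB0 : measurable B0 by exact: mZ.
(* Fubini: for every (resp. almost every) parameter, almost all draws are good;
   so, for almost all draws, almost every parameter is good. *)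
have H1 : {ae power_measure P n, forall w, leb (xsection B1 w) = 0%E}.
  apply/prod_null_xsection => //; apply/prod_null_ysection => //.
  apply: aeW => t.
  apply: ae_null; first exact: measurable_ysection.
  have := tilted_alm_view2_ae t; apply: filterS => w Hw.
  by rewrite /ysection /= in_setE.
have H0 : {ae power_measure P n, forall w, leb (xsection B0 w) = 0%E}.
  apply/prod_null_xsection => //; apply/prod_null_ysection => //.
  have := param_generic_ae; apply: filterS => t tg.
  apply: ae_null; first exact: measurable_ysection.
  have := tilted_alm_flat_view_ae tg; apply: filterS => w Hw.
  by rewrite /ysection /= in_setE.
have H2 := tilt_onto_ae Pac nd.
suff F : {ae power_measure P n, forall w, ~ setT w}.
  have P0 := ae_null measurableT F.
  have /eqP := etrans (esym (power_probability_setT P n)) P0.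
  by rewrite onee_eq0.
apply: filterS (filterI H1 (filterI H0 H2)) => w [h1 [h0 [t0 ht0]]] _.
have mx1 := measurable_xsection w mB1; have mx0 := measurable_xsection w mB0.
have h0' := translation_null t0 mx0 h0.
apply: (@power_lebesgue_setT R (1 + d)).
(* The bad parameters of the first family and the translated bad parameters of
   the second one are null, yet together they exhaust the parameter space. *)
have <- : xsection B1 w `|` (tuple_add t0 @^-1` xsection B0 w) = setT.
  apply/seteqP; split => // t _ /=; rewrite /xsection /= !in_setE /B1 /B0 /Z /=.
  rewrite (tilted_alm_shift t ht0).
  have [z|z] := pselect (zero_first (dec (tilted_alm flat_view w
    (tuple_add t0 t)))); by [right|left].
have mt := measurable_preimage (measurable_tuple_add t0) mx0.
exact: null_set_setU.
Qed.

End exact_decoder.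
End tilted_models.

Theorem theorem5 (R : realType) (d1 d2 n : nat)
    (hd1 : (0 < d1)%N) (hd2 : (0 < d2)%N) (hn : (0 < n)%N) :
  ((d1 + d2 + 1 <= n)%N -> exactly_matchable R d1 d2 n) /\
  ((n < d1 + d2 + 1)%N -> ~ exactly_matchable R d1 d2 n).
Proof.
split; first exact: exactly_matchable_of_many.
rewrite addn1 ltnS => nd [dec mdec match_dec].
have [P Pac] := exists_abs_continuous R (d1 + d2).
have d_gt0 : (0 < d1 + d2)%N by rewrite addn_gt0 hd1.
exact: (not_matchable_of_few (Ordinal hd2) (Ordinal hd1) mdec
  (match_dec _ P d_gt0 Pac) Pac nd).
Qed.
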